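(* Let $n\ge 1$ and $0\le k\le n$. The characters $\sigma_k^{(n)}$ and $\psi_k^{(n)}$ of $G_n=GL(n,q)$ are related by the formulas $$\sigma_k^{(n)}=\sum_{j=0}^k \binom{k}{j}_q \psi_j^{(n)},\qquad \psi_k^{(n)}=\sum_{j=0}^k (-1)^{k-j}q^{\binom{k-j}{2}}\binom{k}{j}_q\,\sigma_j^{(n)} .$$
   Context: $q$ is a prime power and $G_n=GL(n,q)$. For $k\ge1$ let $X_k^{(n)}$ be the set of all $n\times k$ matrices over $\mathbb{F}_q$, and for $1\le k\le n$ let $Y_k^{(n)}\subset X_k^{(n)}$ be the set of those of rank $k$; $G_n$ acts on both by left multiplication. $\sigma_k^{(n)}$ is the character of the permutation representation in $\mathbb{C}[X_k^{(n)}]$ and $\psi_k^{(n)}$ the character of the permutation representation in $\mathbb{C}[Y_k^{(n)}]$; $\sigma_0^{(n)}=\psi_0^{(n)}\equiv1$. The $q$-binomial coefficient is $$\binom{k}{j}_q=\frac{(q^k-1)(q^{k-1}-1)\cdots(q^{k-j+1}-1)}{(q^j-1)(q^{j-1}-1)\cdots(q-1)},$$ the number of $j$-dimensional subspaces of $\mathbb{F}_q^k$. *)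

(* Defs.v *)
From HB Require Import structures.
From mathcomp Require Import all_boot all_order all_algebra all_fingroup.
From mathcomp Require Import all_solvable all_field all_character.

Set Implicit Arguments.
Unset Strict Implicit.
Unset Printing Implicit Defensive.

Import Order.TTheory GRing.Theory Num.Theory.
Local Open Scope ring_scope.

Section PermutationCharacters.

Variables (F : finFieldType) (n k : nat).

(* {'GL_n[F]} consists of matrices of size n.-1.+1, which is n when 0 < n. *)
Local Notation matT := 'M[F]_(n.-1.+1, k).

Definition GL_stable (S : {set matT}) : Prop :=
  forall (g : {'GL_n[F]}) (A : matT), A \in S -> GLval g *m A \in S.

(* In the basis (e_A)_(A in S) of C[S], the matrix, acting on column vectors,
   of the linear map e_A |-> e_(gA). The complex numbers are represented by
   algC, over which MathComp's characters are defined. *)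
Definition GL_perm_mx (S : {set matT}) (g : {'GL_n[F]}) : 'M[algC]_#|S| :=
  \matrix_(i, j) (enum_val i == GLval g *m enum_val j)%:R.

Lemma GL_perm_mx_repr (S : {set matT}) :
  GL_stable S -> mx_repr 'GL_n[F] (GL_perm_mx S).
Proof.
move=> stS; split=> [|g h _ _]; apply/matrixP=> i j; rewrite !mxE.
  by rewrite GL_1E mul1mx (inj_eq enum_val_inj).
have hjS : GLval h *m enum_val j \in S by apply/stS/enum_valP.
rewrite (bigD1 (enum_rank_in hjS (GLval h *m enum_val j))) //= big1 ?addr0.
  by rewrite !mxE enum_rankK_in // eqxx mulr1 mulmxA.
move=> l neq_l; rewrite !mxE; case: (enum_val l =P _) => [El|_].
  by case/eqP: neq_l; apply: enum_val_inj; rewrite enum_rankK_in.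
by rewrite mulr0.
Qed.

Definition GL_perm_repr (S : {set matT}) (stS : GL_stable S) :
    mx_representation algC 'GL_n[F] #|S| :=
  MxRepresentation (GL_perm_mx_repr stS).

Definition Xset : {set matT} := [set: matT].
Definition Yset : {set matT} := [set A : matT | \rank A == k].

Lemma Xset_stable : GL_stable Xset.
Proof. by move=> g A _; rewrite inE. Qed.

Lemma Yset_stable : GL_stable Yset.
Proof.
move=> g A; rewrite !inE => rkA.
by rewrite (eqmxMfull A) // row_full_unit; apply: GL_unit.
Qed.

Definition sigma : 'CF('GL_n[F]) := cfRepr (GL_perm_repr Xset_stable).
Definition psi : 'CF('GL_n[F]) := cfRepr (GL_perm_repr Yset_stable).

End PermutationCharacters.

(* For k = 0 both sets consist of the empty matrix, so that the uniform
   definitions agree with the convention that sigma_0 and psi_0 are the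
   constant 1. *)
Lemma sigma0 (F : finFieldType) (n : nat) : sigma F n 0 = 1.
Proof.
apply/cfunP=> g; rewrite cfunE cfun1E in_setT /mxtrace.
rewrite (eq_bigr (fun=> 1)) => [|i _]; last by rewrite mxE !thinmx0 eqxx.
by rewrite sumr_const card_ord cardsT card_mx muln0 expn0.
Qed.

Lemma psi0 (F : finFieldType) (n : nat) : psi F n 0 = 1.
Proof.
have YX : Yset F n 0 = Xset F n 0.
  by apply/setP=> A; rewrite !inE -leqn0 rank_leq_col.
apply/cfunP=> g; rewrite cfunE cfun1E in_setT /mxtrace.
rewrite (eq_bigr (fun=> 1)) => [|i _]; last by rewrite mxE !thinmx0 eqxx.
by rewrite sumr_const card_ord YX cardsT card_mx muln0 expn0.
Qed.

Definition qbinom (q k j : nat) : algC :=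
  (\prod_(i < j) (q%:R ^+ (k - i) - 1)) / (\prod_(i < j) (q%:R ^+ (j - i) - 1)).

(* Main.v *)
Require Import Defs.
From mathcomp Require Import all_boot all_order all_algebra all_fingroup.
From mathcomp Require Import all_solvable all_field all_character.
From mathcomp Require Import ring.
Import Order.TTheory GRing.Theory Num.Theory.
Local Open Scope ring_scope.

(** The value of a permutation character at g is the number of points fixed
    by g, and a matrix A is fixed by g exactly when each of its columns lies in
    the fixed space W of g on column vectors. Put x = #|W|. Building A one
    column at a time, each new column can be any of the x vectors of W; if A is
    to have full column rank, it has to avoid the span of the i columns already
    chosen, a subspace of W with q^i elements. Hence
      sigma_k(g) = x^k   and   psi_k(g) = (x - 1)(x - q) ... (x - q^(k-1)).
    The two formulas therefore reduce to identities between polynomials in x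
    that express the powers of x and the products on the right in terms of each
    other ([exp_sum_qfall], [qfall_sum_exp]). Both follow by induction on k
    from the q-Pascal rule [qbinom_pascal]. *)

(** * The q-Pascal rule *)

Section QBinomial.

Variable q : nat.
Hypothesis q_gt1 : (1 < q)%N.

Lemma qexp_sub1_neq0 (j : nat) : (0 < j)%N -> q%:R ^+ j - 1 != 0 :> algC.
Proof.
move=> j_gt0; rewrite subr_eq0 -natrX pnatr_eq1 neq_ltn.
by rewrite -{2}(exp1n j) ltn_exp2r // q_gt1 orbT.
Qed.

Lemma qbinom0 (k : nat) : qbinom q k 0 = 1.
Proof. by rewrite /qbinom !big_ord0 divr1. Qed.

Lemma qbinom_small (k j : nat) : (k < j)%N -> qbinom q k j = 0.
Proof.
move=> lt_kj; rewrite /qbinom (bigD1 (Ordinal lt_kj)) //=.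
by rewrite subnn expr0 subrr !mul0r.
Qed.

Lemma qbinomSS (k j : nat) :
  qbinom q k.+1 j.+1
    = qbinom q k j * ((q%:R ^+ k.+1 - 1) / (q%:R ^+ j.+1 - 1)).
Proof.
rewrite /qbinom big_ord_recl [X in _ / X]big_ord_recl !subn0.
under eq_bigr => i _ do rewrite lift0 subSS.
under [X in _ / (_ * X)]eq_bigr => i _ do rewrite lift0 subSS.
by rewrite -mulf_div mulrC.
Qed.

Lemma qbinomS (k j : nat) :
  qbinom q k j.+1
    = qbinom q k j * ((q%:R ^+ (k - j) - 1) / (q%:R ^+ j.+1 - 1)).
Proof.
rewrite /qbinom big_ord_recr [X in _ / X]big_ord_recl !subn0.
under [X in _ / (_ * X)]eq_bigr => i _ do rewrite lift0 subSS.
by rewrite mulf_div [X in _ / X]mulrC.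
Qed.

(** Both binomials with lower index j.+1 are multiples of [qbinom q k j], and
    q^(k+1) - 1 = (q^(j+1) - 1) + q^(j+1) (q^(k-j) - 1). *)
Lemma qbinom_pascal (k j : nat) :
  qbinom q k.+1 j.+1 = qbinom q k j + q%:R ^+ j.+1 * qbinom q k j.+1.
Proof.
have [le_jk | lt_kj] := leqP j k; last first.
  by rewrite !qbinom_small ?mulr0 ?addr0 // ltnW.
rewrite qbinomSS qbinomS.
have -> : k.+1 = (j.+1 + (k - j))%N by rewrite addSn subnKC.
rewrite exprD; have nz := qexp_sub1_neq0 j.+1 isT.
by move: nz; move: (_ ^+ j.+1) (_ ^+ (k - j)) => a b nz; field.
Qed.

(** * Powers and their q-analogues *)

(** A q-analogue of the falling factorial: for x = q^d, it counts the
    injective linear maps from a space of dimension k into one of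
    dimension d. *)
Definition qfall (x : algC) (k : nat) : algC := \prod_(i < k) (x - q%:R ^+ i).

Lemma qfallS (x : algC) (k : nat) :
  qfall x k.+1 = qfall x k * (x - q%:R ^+ k).
Proof. by rewrite /qfall big_ord_recr. Qed.

(** Multiplying the expansion of x^k by x and using
    x * qfall x j = qfall x j.+1 + q^j * qfall x j collects, in front of
    qfall x j.+1, the right-hand side of the q-Pascal rule. *)
Lemma exp_sum_qfall (x : algC) (k : nat) :
  x ^+ k = \sum_(0 <= j < k.+1) qbinom q k j * qfall x j.
Proof.
elim: k => [|k IHk].
  by rewrite big_nat1 qbinom0 /qfall big_ord0 mulr1.
rewrite exprS IHk mulr_sumr.
rewrite (eq_bigr (fun j => qbinom q k j * qfall x j.+1
                           + q%:R ^+ j * qbinom q k j * qfall x j)); last first.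
  by move=> j _; rewrite qfallS; ring.
rewrite big_split /= [RHS]big_nat_recl // [X in _ + X]big_nat_recl //.
rewrite !qbinom0 expr0 addrCA mul1r; congr (_ + _).
(* The last term of the shifted sum vanishes, so its range can be extended. *)
have -> : \sum_(0 <= i < k) q%:R ^+ i.+1 * qbinom q k i.+1 * qfall x i.+1
   = \sum_(0 <= i < k.+1) q%:R ^+ i.+1 * qbinom q k i.+1 * qfall x i.+1.
  by rewrite big_nat_recr //= qbinom_small // mulr0 mul0r addr0.
by rewrite -big_split; apply: eq_bigr => j _; rewrite qbinom_pascal mulrDl.
Qed.

(** Coefficients of x^(j+1) in qfall x k.+1 = (x - q^k) * qfall x k. With
    m = k - j - 1, the exponents of q on the two sides agree because
    'C(m + 1, 2) = 'C(m, 2) + m and m + j + 1 = k. *)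
Lemma qfall_coef_rec (k j : nat) :
  (-1) ^+ (k.+1 - j.+1) * q%:R ^+ 'C(k.+1 - j.+1, 2) * qbinom q k.+1 j.+1
  = (-1) ^+ (k - j) * q%:R ^+ 'C(k - j, 2) * qbinom q k j
    - q%:R ^+ k
      * ((-1) ^+ (k - j.+1) * q%:R ^+ 'C(k - j.+1, 2) * qbinom q k j.+1).
Proof.
rewrite subSS qbinom_pascal.
have [lt_jk | le_kj] := ltnP j k; last first.
  by rewrite (qbinom_small k j.+1) // !mulr0 addr0 subr0.
have -> : (k - j = (k - j.+1).+1)%N by rewrite subnSK.
rewrite [X in _ - q%:R ^+ X * _](_ : k = (j.+1 + (k - j.+1))%N).
  2: by rewrite subnKC.
rewrite binS bin1 !exprD exprS; move: (k - j.+1)%N => m.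
by move: (_ ^+ j.+1) => a; ring.
Qed.

(** This is the finite q-binomial theorem; the induction multiplies the
    expansion of qfall x k by x - q^k. *)
Lemma qfall_sum_exp (x : algC) (k : nat) :
  qfall x k = \sum_(0 <= j < k.+1)
    (-1) ^+ (k - j) * q%:R ^+ 'C(k - j, 2) * qbinom q k j * x ^+ j.
Proof.
elim: k => [|k IHk].
  by rewrite big_nat1 qbinom0 /qfall big_ord0 !mulr1.
rewrite qfallS mulrBr.
have -> : qfall x k * x = \sum_(0 <= j < k.+1)
    (-1) ^+ (k - j) * q%:R ^+ 'C(k - j, 2) * qbinom q k j * x ^+ j.+1.
  by rewrite IHk mulr_suml; apply: eq_bigr => j _; rewrite exprS; ring.
rewrite IHk [RHS]big_nat_recl // [X in _ - X * _]big_nat_recl // mulrDl opprD.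
rewrite addrCA; congr (_ + _).
  by rewrite !subn0 !qbinom0 !expr0 binS bin1 exprD exprS; ring.
(* Again the range grows by a vanishing term, to match the other sum. *)
have -> : \sum_(0 <= j < k) (-1) ^+ (k - j.+1) * q%:R ^+ 'C(k - j.+1, 2)
      * qbinom q k j.+1 * x ^+ j.+1
  = \sum_(0 <= j < k.+1) (-1) ^+ (k - j.+1) * q%:R ^+ 'C(k - j.+1, 2)
      * qbinom q k j.+1 * x ^+ j.+1.
  by rewrite big_nat_recr //= (qbinom_small k k.+1) // mulr0 mul0r addr0.
rewrite mulr_suml -sumrB; apply: eq_bigr => j _.
by rewrite qfall_coef_rec; ring.
Qed.

End QBinomial.

(** * Counting fixed matrices *)

Section FixedMatrices.

Variables (F : finFieldType) (m : nat) (g : 'M[F]_m).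

Definition fixed_mx (k : nat) : {set 'M[F]_(m, k)} :=
  [set A | g *m A == A].

Definition fixed_rank_mx (k : nat) : {set 'M[F]_(m, k)} :=
  [set A in fixed_mx k | \rank A == k].

(** Removal of the first column: 1 + k is convertible to k.+1, so this applies
    directly in an induction on the number of columns. *)
Lemma sum_row_mx (k : nat) (f : 'M[F]_(m, 1 + k) -> algC) :
  \sum_A f A = \sum_(B : 'M[F]_(m, k)) \sum_(c : 'cV[F]_m) f (row_mx c B).
Proof.
rewrite pair_bigA.
rewrite (reindex (fun p : 'M[F]_(m, k) * 'cV[F]_m => row_mx p.2 p.1)) //=.
exists (fun A => (rsubmx A, lsubmx A)) => [[B c] _ | A _] /=.
  by rewrite row_mxKl row_mxKr.
by rewrite hsubmxK.
Qed.

Lemma natr_card_sum (T : finType) (P : {set T}) :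
  (#|P|%:R : algC) = \sum_x (x \in P)%:R.
Proof.
rewrite -sum1_card natr_sum big_mkcond.
by apply: eq_bigr => x _; case: ifP.
Qed.

Lemma fixed_row_mx (k : nat) (c : 'cV[F]_m) (B : 'M[F]_(m, k)) :
  (row_mx c B \in fixed_mx (1 + k)) = (c \in fixed_mx 1) && (B \in fixed_mx k).
Proof.
rewrite !inE mul_mx_row.
by apply/eqP/andP => [/eq_row_mx[-> ->] | [/eqP-> /eqP->]].
Qed.

Lemma mxrank_row_mx (k : nat) (c : 'cV[F]_m) (B : 'M[F]_(m, k)) :
  (\rank (row_mx c B) == k.+1) = (\rank B == k) && ~~ (c^T <= B^T)%MS.
Proof.
rewrite -(mxrank_tr (row_mx c B)) tr_row_mx -(mxrank_tr B) -addsmxE.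
have rkB := rank_leq_row B^T.
have [sub_cB | nsub_cB] := boolP (c^T <= B^T)%MS.
  by rewrite andbF (addsmx_idPr sub_cB) eqn_leq ltnNge rkB andbF.
rewrite andbT.
have -> : \rank (c^T + B^T) = (\rank B^T).+1; last by rewrite eqSS.
apply/eqP; rewrite eqn_leq; apply/andP; split.
  apply: leq_trans (mxrank_adds_leqif _ _) _.
  by rewrite -[X in (_ <= X)%N]add1n leq_add2r rank_leq_row.
apply: rank_ltmx.
rewrite /ltmx addsmxSr /=.
by apply: contra nsub_cB; apply/submx_trans/addsmxSl.
Qed.

Lemma card_fixed_mx (k : nat) :
  (#|fixed_mx k|%:R : algC) = #|fixed_mx 1|%:R ^+ k.
Proof.
elim: k => [|k IHk].
  rewrite (_ : fixed_mx 0 = setT); first by rewrite cardsT card_mx muln0.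
  by apply/setP=> A; rewrite !inE thinmx0 [A]thinmx0 eqxx.
rewrite exprSr -IHk !natr_card_sum big_distrl /= (@sum_row_mx k).
apply: eq_bigr => B _; rewrite big_distrr /=; apply: eq_bigr => c _.
by rewrite fixed_row_mx andbC -natrM mulnb.
Qed.

(** The columns to be avoided are the vectors B u; they are fixed because B
    is, and u is determined by B u because B has full column rank. *)
Lemma card_fixed_nspan (k : nat) (B : 'M[F]_(m, k)) :
  B \in fixed_rank_mx k ->
  (#|[set c in fixed_mx 1 | ~~ (c^T <= B^T)%MS]|%:R : algC)
    = #|fixed_mx 1|%:R - #|F|%:R ^+ k.
Proof.
rewrite inE => /andP[]; rewrite inE => /eqP fixB rkB.
pose S := [set B *m u | u : 'cV[F]_k].
have memS c : (c \in S) = (c^T <= B^T)%MS.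
  apply/imsetP/submxP => [[u _ ->] | [u Ec]].
    by exists u^T; rewrite trmx_mul.
  by exists u^T => //; apply: trmx_inj; rewrite trmx_mul trmxK.
have cardS : #|S| = (#|F| ^ k)%N.
  rewrite card_imset ?card_mx ?muln1 // => u v /(congr1 trmx).
  rewrite !trmx_mul => /(row_free_inj _) Euv; apply: trmx_inj; apply: Euv.
  by rewrite /row_free mxrank_tr.
have subS : S \subset fixed_mx 1.
  by apply/subsetP=> _ /imsetP[u _ ->]; rewrite inE mulmxA fixB.
rewrite (_ : [set _ in _ | _] = fixed_mx 1 :\: S); last first.
  by apply/setP=> c; rewrite in_setD memS inE andbC.
by rewrite cardsD (setIidPr subS) natrB ?subset_leq_card // cardS natrX.
Qed.

(** By [mxrank_row_mx], each fixed B of full column rank contributes the factor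
    x - q^k of [card_fixed_nspan] to the next count. This difference is negative
    when x < q^k, but then there is no such B and an earlier factor is 0. *)
Lemma card_fixed_rank_mx (k : nat) :
  (#|fixed_rank_mx k|%:R : algC) = qfall #|F| #|fixed_mx 1|%:R k.
Proof.
elim: k => [|k IHk].
  rewrite (_ : fixed_rank_mx 0 = fixed_mx 0).
    by rewrite card_fixed_mx /qfall big_ord0.
  by apply/setP=> A; rewrite inE thinmx0 mxrank0 andbT.
rewrite qfallS -IHk natr_card_sum (@sum_row_mx k) natr_card_sum big_distrl /=.
apply: eq_bigr => B _; have [fixB | nfixB] := boolP (B \in _); last first.
  rewrite mul0r big1 // => c _; move: nfixB.
  rewrite ![_ \in fixed_rank_mx _]in_set fixed_row_mx mxrank_row_mx.
  rewrite negb_and.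
  by case/orP=> /negbTE->; rewrite ?(andbF, andFb).
rewrite mul1r -(card_fixed_nspan k B fixB) natr_card_sum.
apply: eq_bigr => c _; move: fixB.
rewrite ![_ \in fixed_rank_mx _]in_set => /andP[fixB rkB].
by rewrite fixed_row_mx mxrank_row_mx rkB fixB !inE andbT.
Qed.

End FixedMatrices.

(** * Character values *)

Lemma GL_perm_charE (F : finFieldType) (n k : nat)
    (S : {set 'M[F]_(n.-1.+1, k)}) (stS : GL_stable S) (g : {'GL_n[F]}) :
  cfRepr (GL_perm_repr stS) g = #|[set A in S | GLval g *m A == A]|%:R.
Proof.
rewrite cfunE in_setT /mxtrace.
under eq_bigr => i _ do rewrite mxE.
rewrite -(big_enum_val (fun A => (A == GLval g *m A)%:R)) natr_card_sum.
rewrite big_mkcond; apply: eq_bigr => A _; rewrite inE eq_sym.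
by case: (A \in S).
Qed.

Lemma sigmaE (F : finFieldType) (n k : nat) (g : {'GL_n[F]}) :
  sigma F n k g = #|fixed_mx F _ (GLval g) 1|%:R ^+ k.
Proof.
rewrite GL_perm_charE -card_fixed_mx; congr (#|pred_of_set _|%:R).
by apply/setP=> A; rewrite !inE.
Qed.

Lemma psiE (F : finFieldType) (n k : nat) (g : {'GL_n[F]}) :
  psi F n k g = qfall #|F| #|fixed_mx F _ (GLval g) 1|%:R k.
Proof.
rewrite GL_perm_charE -card_fixed_rank_mx; congr (#|pred_of_set _|%:R).
by apply/setP=> A; rewrite !inE andbC.
Qed.

Theorem proposition5 (F : finFieldType) (n k : nat)
    (hn : (0 < n)%N) (hk : (k <= n)%N) :
  sigma F n k = \sum_(0 <= j < k.+1) qbinom #|F| k j *: psi F n j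
  /\
  psi F n k =
    \sum_(0 <= j < k.+1)
       ((-1) ^+ (k - j) * #|F|%:R ^+ 'C(k - j, 2) * qbinom #|F| k j)
         *: sigma F n j.
Proof.
have q_gt1 : (1 < #|F|)%N := finNzRing_gt1 F.
split; apply/cfunP=> g; rewrite sum_cfunE.
  rewrite sigmaE (exp_sum_qfall _ q_gt1).
  by apply: eq_bigr => j _; rewrite cfunE psiE.
rewrite psiE (qfall_sum_exp _ q_gt1).
by apply: eq_bigr => j _; rewrite cfunE sigmaE.
Qed.
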